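(* Let $k\in\mathbb{N}$. Then there is a graph with girth at least $k$ which does not admit a KT orientation.
   Context: All graphs are finite and simple. The girth of a graph is the length of a shortest cycle ($\infty$ if there is no cycle). An orientation $D$ of a graph $G$ is a KT orientation if for all distinct vertices $u,v$ there is at most one directed path (in any direction) between $u$ and $v$ in $D$, i.e. the total number of directed paths from $u$ to $v$ and from $v$ to $u$ is at most one. A graph admits a KT orientation if at least one of its orientations is a KT orientation. *)

(* Defs.v *)
From mathcomp Require Import all_boot.

Set Implicit Arguments.
Unset Strict Implicit.
Unset Printing Implicit Defensive.

Record sgraph : Type := SGraph {
  vertex :> finType;
  adj : rel vertex;
  adj_sym : symmetric adj;
  adj_irrefl : irreflexive adj
}.

(* A cycle is a closed walk on distinct vertices; the bound [2 < n] excludes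
   the empty sequence and a single edge traversed back and forth, which
   [ucycleb] accepts. *)
Definition has_cycle (G : sgraph) (n : nat) : bool :=
  (2 < n) && [exists c : n.-tuple G, ucycleb (@adj G) c].

(* [None] stands for infinite girth; a cycle has at most [#|G|] vertices. *)
Definition girth (G : sgraph) : option nat :=
  ohead [seq n <- iota 0 #|G|.+1 | has_cycle G n].

Definition girth_at_least (k : nat) (G : sgraph) : bool :=
  if girth G is Some g then k <= g else true.

Definition orientation (G : sgraph) (D : rel G) : Prop :=
  forall x y : G, adj x y = D x y || D y x /\ ~~ (D x y && D y x).

(* [s] lists all the vertices of the path, both ends included. *)
Definition dipath (T : finType) (D : rel T) (u v : T) (s : seq T) : bool :=
  if s is x :: p then [&& x == u, last x p == v, path D x p & uniq s]
  else false.

(* A path has distinct vertices, so bounding its size by [#|T|] loses none. *)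
Definition num_dipaths (T : finType) (D : rel T) (u v : T) : nat :=
  #|[set s : {bseq #|T| of T} | dipath D u v s]|.

Definition KT_orientation (G : sgraph) (D : rel G) : Prop :=
  orientation D /\
  forall u v : G, u != v -> num_dipaths D u v + num_dipaths D v u <= 1.

Definition admits_KT_orientation (G : sgraph) : Prop :=
  exists D : rel G, KT_orientation D.

Lemma girth_at_leastP (k : nat) (G : sgraph) :
  girth_at_least k G <->
  (forall c : seq G, 2 < size c -> ucycle (@adj G) c -> k <= size c).
Proof.
rewrite /girth_at_least /girth.
have memP n : n \in [seq n <- iota 0 #|G|.+1 | has_cycle G n] <->
    exists c : seq G, [/\ size c = n, 2 < size c & ucycle (@adj G) c].
  rewrite mem_filter mem_iota add0n /=; split.
    by case/andP=> /andP[n3 /existsP[c cc]] _; exists c; rewrite size_tuple.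
  case=> c [<- c3 cc]; rewrite /has_cycle c3 /= ltnS.
  apply/andP; split; first by apply/existsP; exists (in_tuple c).
  by case/andP: cc => _ /card_uniqP <-; apply: max_card.
have: sorted ltn [seq n <- iota 0 #|G|.+1 | has_cycle G n].
  exact: (sorted_filter ltn_trans) (iota_ltn_sorted _ _).
case: [seq n <- _ | _] memP => [|g s] memP /= srt.
  split=> // _ c c3 cc.
  by have /memP : exists c' : seq G,
    [/\ size c' = size c, 2 < size c' & ucycle (@adj G) c'] by exists c.
split=> [kg c c3 cc|H].
  have /memP : exists c' : seq G,
    [/\ size c' = size c, 2 < size c' & ucycle (@adj G) c'] by exists c.
  rewrite inE => /orP[/eqP-> //|cs]; apply: leq_trans kg _; apply: ltnW.
  by have /allP := order_path_min ltn_trans srt; apply.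
by have [c [<- c3 cc]] := (memP g).1 (mem_head _ _); apply: H.
Qed.

Lemma num_dipaths_le1P (T : finType) (D : rel T) (u v : T) : u != v ->
  num_dipaths D u v + num_dipaths D v u <= 1 <->
  (forall s t, dipath D u v s || dipath D v u s ->
               dipath D u v t || dipath D v u t -> s = t).
Proof.
move=> uv.
have sz x y s : dipath D x y s -> size s <= #|T|.
  by case: s => // z p /and4P[_ _ _ /card_uniqP <-]; apply: max_card.
pose P x y := [set s : {bseq #|T| of T} | dipath D x y s].
have dis : [disjoint P u v & P v u].
  rewrite -setI_eq0; apply/eqP/setP=> -[[|x p] i]; rewrite !inE //=.
  apply/negP=> /andP[/and4P[/eqP-> _ _ _] /and4P[/eqP xv _ _ _]].
  by rewrite xv eqxx in uv.
have -> : num_dipaths D u v + num_dipaths D v u = #|P u v :|: P v u|.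
  by rewrite cardsU disjoint_setI0 // cards0 subn0.
split=> [/card_le1_eqP H s t hs ht|H].
  have ss : size s <= #|T| by case/orP: hs => /sz.
  have st : size t <= #|T| by case/orP: ht => /sz.
  have E : Bseq ss = Bseq st by apply: H; rewrite !inE.
  exact: (congr1 val E).
apply/card_le1_eqP=> s t; rewrite !inE => hs ht; apply/val_inj.
exact: H.
Qed.

(* Main.v *)
Require Import Defs.
From mathcomp Require Import all_boot.

(** A KT orientation is acyclic, hence increasing for some injective numbering
    of the vertices. It therefore suffices to build a graph of large girth such
    that every numbering of its vertices makes some cycle [v_1 ... v_r]
    increasing: the edge [v_1 v_r] and the path [v_1 ... v_r] are then two
    directed paths. Such a graph is obtained by placing cycles on the edges of
    an [r]-uniform hypergraph of large girth with ordered edges, such that every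
    numbering makes some edge increasing.

    To construct the hypergraph by induction on the girth, one strengthens the
    claim: the edges carry colours, and for every numbering and every vertex
    colouring some increasing edge [e] is monochromatic of its own colour [c],
    and has size at least [rho c]. For a fixed girth, one inducts on
    [\sum_c 3 ^ rho c]. Take a hypergraph [S] of smaller girth with edges of
    size [2 K], and below each edge [y] of [S], of colour [c], a private copy of
    a hypergraph [T c] of the desired girth in which [c] is split into two
    colours, for vertices before and after the middle of [y], with target
    [rho c - 1]. An edge of [T c] having one of these two colours is completed
    by a vertex of [y] from the other half, distinct edges receiving distinct
    vertices. A short cycle leaving the copies would project to a cycle of [S]
    with strictly fewer edges. *)

Set Implicit Arguments.
Unset Strict Implicit.
Unset Printing Implicit Defensive.

(** * Ordered, coloured hypergraphs and sparsity *)

(** Edges are sequences because the order of their vertices matters; [hpoint] serves as the default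
    value of [nth]. *)
Record hypergraph (C : finType) : Type := Hypergraph {
  hvertex : finType;
  hedge : finType;
  hpoint : hvertex;
  hcolor : hedge -> C;
  htuple : hedge -> seq hvertex
}.

Section Hypergraph.
Variables (C : finType) (H : hypergraph C).

Definition shared (F : {set hedge H}) (e : hedge H) : {set hvertex H} :=
  [set v in htuple e | [exists e' in F, (e' != e) && (v \in htuple e')]].

(* Every nonempty set of fewer than [g] edges contains an edge sharing at most
   one vertex with the others, i.e. there is no Berge cycle on fewer than [g]
   edges. Since a forest has two leaves, one edge [e0] may be exempted; this
   is the form which goes through the induction. *)
Definition sparse (g : nat) : Prop :=
  forall (F : {set hedge H}) (e0 : hedge H),
    (exists2 e, e \in F & e != e0) ->
    {in F, forall e, e != e0 -> 1 < #|shared F e|} -> g <= #|F|.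

Definition order_forcing : Prop :=
  forall (f : hvertex H -> nat) (lam : hvertex H -> C), injective f ->
  exists e, pairwise (relpre f ltn) (htuple e) &&
            all (fun v => lam v == hcolor e) (htuple e).

Definition good (rho : C -> nat) (g : nat) : Prop :=
  [/\ forall e : hedge H, uniq (htuple e),
      forall e : hedge H, rho (hcolor e) <= size (htuple e),
      sparse g & order_forcing].

Lemma sharedP (F : {set hedge H}) (e : hedge H) (v : hvertex H) :
  reflect (v \in htuple e /\
           exists e', [/\ e' \in F, e' != e & v \in htuple e'])
          (v \in shared F e).
Proof.
rewrite inE; apply: (iffP andP) => -[ve].
  by case/existsP=> e' /and3P[? ? ?]; split=> //; exists e'.
by case=> e' [? ? ?]; split=> //; apply/existsP; exists e'; apply/and3P.
Qed.

End Hypergraph.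

Arguments shared {C H} F e.

(** * Base cases of the induction *)

(** Sparsity is void for girth 0, so all large enough duplicate-free tuples may be edges. Among
    [M.+1] vertices some colour [q] occurs at least [rho q] times, by pigeonhole. *)
Lemma good_base (C : finType) (rho : C -> nat) :
  exists H : hypergraph C, good H rho 0.
Proof.
pose M := \sum_q rho q.
pose V := 'I_M.+1.
pose E := {p : C * {bseq M.+1 of V} | (rho p.1 <= size p.2) && uniq p.2}.
pose H := @Hypergraph C V E ord0 (fun e => (val e).1) (fun e => (val e).2).
exists H; split=> //.
- by case=> -[q s] /= /andP[].
- by case=> -[q s] /= /andP[].
move=> f lam injf.
have [q hq] : exists q, rho q <= #|[set v : V | lam v == q]|.
  apply/existsP; apply: contraT; rewrite negb_exists => /forallP hlt.
  have: M.+1 <= M.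
    rewrite -{1}(card_ord M.+1) -sum1_card (partition_big lam xpredT) //=.
    apply: leq_sum => q _; rewrite sum1_card; apply: ltnW.
    by have := hlt q; rewrite -ltnNge cardsE.
  by rewrite ltnn.
pose s := sort (relpre f leq) (enum [set v : V | lam v == q]).
have us : uniq s by rewrite sort_uniq enum_uniq.
have ss : size s <= M.+1.
  by rewrite -(card_ord M.+1) -(card_uniqP us) max_card.
have hs : (rho (q, Bseq ss).1 <= size (q, Bseq ss).2) && uniq (q, Bseq ss).2.
  by rewrite /= us andbT size_sort -cardE.
exists (exist _ (q, Bseq ss) hs) => /=; apply/andP; split; last first.
  by apply/allP=> v; rewrite mem_sort mem_enum inE.
rewrite -pairwise_map -sorted_pairwise; last exact: ltn_trans.
rewrite ltn_sorted_uniq_leq map_inj_uniq // us sorted_map.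
by apply: sort_sorted => x y /=; apply: leq_total.
Qed.

(** A single empty edge of colour [q] is vacuously increasing and monochromatic. *)
Lemma good_trivial (C : finType) (rho : C -> nat) (g : nat) (q : C) :
  rho q = 0 -> exists H : hypergraph C, good H rho g.
Proof.
move=> rq; exists (@Hypergraph C unit unit tt (fun=> q) (fun=> [::])).
split=> //=; first by rewrite rq.
  by move=> F [] [[] _].
by move=> f lam _; exists tt.
Qed.

Lemma big_option_nat (C : finType) (F : option C -> nat) :
  \sum_o F o = F None + \sum_q F (Some q).
Proof.
have sumE (T : finType) (G : T -> nat) : \sum_x G x = \sum_(x <- enum T) G x.
  by rewrite big_enum.
have enumE : enum {: option C} = None :: map some (enum C).
  by rewrite !enumT [in LHS]unlock.
by rewrite !sumE enumE big_cons big_map.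
Qed.

(** * Amalgamation: raising the girth by one *)

Section Amalgamation.
Variables (C : finType) (g K : nat) (rho : C -> nat).

(* [Some c] stands for [c] before the middle of the edge, [None] for [c] after it. *)
Definition split_target (c : C) (o : option C) : nat :=
  if o is Some q then rho q - (q == c) else (rho c).-1.

Variables (S : hypergraph C) (T : C -> hypergraph (option C)).
Hypothesis rho_gt0 : forall q, 0 < rho q.
Hypothesis S_good : good S (fun=> K + K) g.
Hypothesis T_good : forall c, good (T c) (split_target c) g.+1.
Hypothesis T_small : forall c, #|hedge (T c)| <= K.

Let V : finType := (hvertex S + {y : hedge S & hvertex (T (hcolor y))})%type.
Let E : finType := {y : hedge S & hedge (T (hcolor y))}.

(** Edges coloured [None] are meant for vertices after the middle, so their anchor lies in the first
    half; the rank makes anchors distinct. *)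
Definition anchor_index (c : C) (e : hedge (T c)) : nat :=
  if hcolor e is None then enum_rank e : nat else K + enum_rank e.

Definition anchor (y : hedge S) (e : hedge (T (hcolor y))) : hvertex S :=
  nth (hpoint S) (htuple y) (anchor_index e).

Definition copy (y : hedge S) (v : hvertex (T (hcolor y))) : V :=
  inr (Tagged (fun y => hvertex (T (hcolor y))) v).

Definition amalgam_color (u : E) : C :=
  if hcolor (tagged u) is Some q then q else hcolor (tag u).

(** The anchor makes up for the vertex that [split_target] takes away, and stands at the end where
    it keeps the tuple increasing. Edges whose colour was not split get none. *)
Definition amalgam_tuple (u : E) : seq V :=
  let s := map (@copy (tag u)) (htuple (tagged u)) in
  if hcolor (tagged u) is Some q then
    if q == hcolor (tag u) then rcons s (inl (anchor (tagged u))) else s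
  else inl (anchor (tagged u)) :: s.

Definition amalgam : hypergraph C :=
  @Hypergraph C V E (inl (hpoint S)) amalgam_color amalgam_tuple.

Let mk (y : hedge S) (e : hedge (T (hcolor y))) : E :=
  Tagged (fun y => hedge (T (hcolor y))) e.

Lemma mk_inj (y : hedge S) : injective (@mk y).
Proof. by move=> e e' ee'; apply: eq_from_Tagged ee'. Qed.

Lemma anchor_index_lt (c : C) (e : hedge (T c)) : anchor_index e < K + K.
Proof.
have lt_eK: enum_rank e < K := leq_trans (ltn_ord _) (T_small c).
rewrite /anchor_index; case: (hcolor e) => [_|]; first by rewrite ltn_add2l.
exact: ltn_addr.
Qed.

Lemma anchor_index_inj (c : C) : injective (@anchor_index c).
Proof.
move=> e e'.
have ltK (x : hedge (T c)) : enum_rank x < K.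
  exact: leq_trans (ltn_ord _) (T_small c).
rewrite /anchor_index; case: (hcolor e) => [_|]; case: (hcolor e') => [_|].
- by move/addnI/ord_inj/enum_rank_inj.
- by move=> h; have := ltK e'; rewrite -h ltnNge leq_addr.
- by move=> h; have := ltK e; rewrite h ltnNge leq_addr.
- by move/ord_inj/enum_rank_inj.
Qed.

Lemma anchor_index_size (y : hedge S) (e : hedge (T (hcolor y))) :
  anchor_index e < size (htuple y).
Proof.
by have [_ sz _ _] := S_good; apply: leq_trans (anchor_index_lt e) (sz y).
Qed.

Lemma anchor_inj (y : hedge S) : injective (@anchor y).
Proof.
have [us _ _ _] := S_good; move=> e e' /eqP.
rewrite nth_uniq ?us ?anchor_index_size // => /eqP.
exact: anchor_index_inj.
Qed.

Lemma mem_anchor (y : hedge S) (e : hedge (T (hcolor y))) :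
  anchor e \in htuple y.
Proof. exact/mem_nth/anchor_index_size. Qed.

Lemma copy_inj (y : hedge S) : injective (@copy y).
Proof. by move=> v w vw; apply: eq_from_Tagged (inr_inj vw). Qed.

Lemma inl_notin_copies (y : hedge S) (s : seq (hvertex (T (hcolor y)))) a :
  inl a \notin map (@copy y) s.
Proof. by apply/mapP => -[]. Qed.

Lemma inl_amalgam_tuple (y : hedge S) (e : hedge (T (hcolor y))) a :
  inl a \in amalgam_tuple (mk e) -> a = anchor e.
Proof.
rewrite /amalgam_tuple /=; case: (hcolor e) => [q|].
  case: ifP => _; last by rewrite (negPf (inl_notin_copies _ _)).
  rewrite mem_rcons inE (negPf (inl_notin_copies _ _)) orbF.
  by move/eqP => [].
by rewrite inE (negPf (inl_notin_copies _ _)) orbF => /eqP[].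
Qed.

Lemma inr_amalgam_tuple (u : E) z :
  inr z \in amalgam_tuple u -> inr z \in map (@copy (tag u)) (htuple (tagged u)).
Proof.
rewrite /amalgam_tuple /=; case: (hcolor _) => [q|]; last by rewrite inE.
by case: ifP => _ //; rewrite mem_rcons inE.
Qed.

Lemma amalgam_tuple_uniq (u : E) : uniq (amalgam_tuple u).
Proof.
case: u => y e; rewrite /amalgam_tuple /=.
have us : uniq (map (@copy y) (htuple e)).
  rewrite map_inj_uniq; last exact: copy_inj.
  by have [us _ _ _] := T_good (hcolor y).
case: (hcolor e) => [q|]; last by rewrite /= inl_notin_copies.
by case: ifP => // _; rewrite rcons_uniq inl_notin_copies.
Qed.

Lemma amalgam_tuple_size (u : E) :
  rho (amalgam_color u) <= size (amalgam_tuple u).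
Proof.
case: u => y e; rewrite /amalgam_tuple /amalgam_color /=.
have [_ sz _ _] := T_good (hcolor y); have {sz} := sz e.
case: (hcolor e) => [q|] /=; last by rewrite size_map -ltnS prednK.
case: ifP => [/eqP->|/negbT nq]; last by rewrite size_map subn0.
by rewrite size_rcons size_map subn1 -ltnS prednK.
Qed.

(** * Sparsity of the amalgam *)

Section Sparse.
Variable F : {set E}.

Let part (y : hedge S) : {set hedge (T (hcolor y))} := [set e | mk e \in F].
Let tags : {set hedge S} := [set tag u | u in F].

Lemma card_part (y : hedge S) : #|part y| <= #|F|.
Proof.
rewrite -(card_imset (mem (part y)) (@mk_inj y)).
by apply/subset_leq_card/subsetP => _ /imsetP[e + ->]; rewrite inE.
Qed.

(** Copies are disjoint, so edges meeting in a copied vertex come from the same copy. *)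
Lemma shared_copy (y : hedge S) (e : hedge (T (hcolor y))) z :
  inr z \in @shared C amalgam F (mk e) ->
  exists2 v, inr z = copy v & v \in shared (part y) e.
Proof.
case/sharedP => /inr_amalgam_tuple /mapP[v ve zv].
case=> -[y' e'] [e'F ne' /inr_amalgam_tuple /mapP[v' ve' zv']].
exists v => //; apply/sharedP; split=> //.
move: (zv'); rewrite zv => -[yy'].
subst y' => _.
have vv' : v = v' by apply: (@copy_inj y); rewrite -zv zv'.
exists e'; split; first by rewrite inE.
  by apply: contra ne' => /eqP->.
by rewrite vv'.
Qed.

(** Edges of one copy have distinct anchors, so an anchor can only be shared with another copy, that
    is, through another edge of [S]. *)
Lemma shared_anchor (y : hedge S) (e : hedge (T (hcolor y))) a :
  mk e \in F -> inl a \in @shared C amalgam F (mk e) ->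
  a = anchor e /\ anchor e \in shared tags y.
Proof.
move=> eF /sharedP[/inl_amalgam_tuple aE] [[y' e'] [e'F ne' /inl_amalgam_tuple aE']].
split=> //; apply/sharedP; split; first exact: mem_anchor.
exists y'; split.
- by apply/imsetP; exists (mk e').
- apply: contra ne' => /eqP yy'; subst y'.
  by have := @anchor_inj y e e'; rewrite -aE -aE' => /(_ erefl) ->.
- by rewrite -aE aE' mem_anchor.
Qed.

(** An edge contains at most one vertex of [S], its anchor, so of two shared vertices at least one
    lies in the copy. *)
Lemma two_shared (y : hedge S) (e : hedge (T (hcolor y))) :
  mk e \in F -> 1 < #|@shared C amalgam F (mk e)| ->
  (exists2 e', e' \in part y & e' != e) /\
  (#|shared (part y) e| <= 1 -> anchor e \in shared tags y).
Proof.
move=> eF /card_gt1P[v [w [hv hw vw]]].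
have shared_other x : x \in shared (part y) e -> 
    exists2 e', e' \in part y & e' != e.
  by case/sharedP => _ [e' [? ? _]]; exists e'.
case: v hv vw => [a|v] hv vw; case: w hw vw => [b|w] hw vw.
- have [ae _] := shared_anchor eF hv; have [be _] := shared_anchor eF hw.
  by rewrite ae be eqxx in vw.
- have [_ h] := shared_anchor eF hv; have [x _ hx] := shared_copy hw.
  by split=> //; apply: shared_other hx.
- have [_ h] := shared_anchor eF hw; have [x _ hx] := shared_copy hv.
  by split=> //; apply: shared_other hx.
have [x vx hx] := shared_copy hv; have [x' wx' hx'] := shared_copy hw.
split; first exact: shared_other hx.
rewrite leqNgt => /card_gt1P[]; exists x, x'; split=> //.
by apply: contra vw => /eqP xx'; rewrite vx wx' xx'.
Qed.

End Sparse.

(** If the part of [F] in some copy has no leaf besides an exempted edge, sparsity of [T] applies.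
    Otherwise each copy met by [F], except that of [u0], has two leaves, whose anchors are two
    shared vertices of its edge of [S]. Sparsity of [S] then bounds the number of tags. *)
Lemma amalgam_sparse : @sparse C amalgam g.+1.
Proof.
move=> F u0 [u uF uu0] coreF.
pose part (y : hedge S) : {set hedge (T (hcolor y))} := [set e | mk e \in F].
pose tags : {set hedge S} := [set tag u | u in F].
pose core y (e1 : hedge (T (hcolor y))) :=
  [exists e in part y, e != e1] &&
  [forall e in part y, (e != e1) ==> (1 < #|shared (part y) e|)].
have [/existsP[y /existsP[e1]]|] := boolP [exists y, exists e1, @core y e1].
  case/andP=> /existsP[e /andP[ey ee1]] /forall_inP h.
  apply: leq_trans (card_part F y); have [_ _ sp _] := T_good (hcolor y).
  apply: (sp _ e1); first by exists e.
  by move=> e' e'y /(implyP (h _ e'y)).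
rewrite negb_exists => /forallP no_core.
have leaf y (e1 e : hedge (T (hcolor y))) : e \in part y -> e != e1 ->
    exists e', [/\ e' \in part y, e' != e1 & #|shared (part y) e'| <= 1].
  move=> ey ee1; have := no_core y; rewrite negb_exists => /forallP/(_ e1).
  rewrite negb_and; case/orP => [/existsP[]|]; first by exists e; apply/andP.
  rewrite negb_forall => /existsP[e']; rewrite !negb_imply -leqNgt.
  by case/and3P => ? ? ?; exists e'.
(* Exempting first another edge [e1], then the leaf [e2] so found, produces two leaves. *)
have two_leaves y : y \in tags -> y != tag u0 ->
    exists e e', [/\ e \in part y, e' \in part y, e != e',
      anchor e \in shared tags y & anchor e' \in shared tags y].
  move=> /imsetP[[y1 e] eF /= yy1] yu0; subst y1.
  have nu0 (e' : hedge (T (hcolor y))) : mk e' != u0.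
    by apply: contra yu0 => /eqP <-.
  have sh (e' : hedge (T (hcolor y))) : e' \in part y ->
      #|shared (part y) e'| <= 1 -> anchor e' \in shared tags y.
    rewrite inE => e'F; have [_] := two_shared e'F (coreF _ e'F (nu0 _)).
    exact.
  have [[e1 e1y e1e] _] := two_shared eF (coreF _ eF (nu0 _)).
  have [e2 [e2y e2e l2]] := leaf y e e1 e1y e1e.
  have ey : e \in part y by rewrite inE.
  have [|e3 [e3y e32 l3]] := leaf y e2 e ey; first by rewrite eq_sym.
  by exists e3, e2; split=> //; apply: sh.
(* If [u] lies in the copy of [u0], a leaf there other than [u0] leads through its anchor to another
   copy. *)
have [y yt yu0] : exists2 y, y \in tags & y != tag u0.
  case: (eqVneq (tag u) (tag u0)) => [tt|?]; last first.
    by exists (tag u) => //; apply/imsetP; exists u.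
  case: u0 => y0 e0 in uu0 coreF two_leaves tt *.
  case: u => y e in uF uu0 tt *; rewrite /= in tt; subst y0.
  have ey : e \in part y by rewrite inE.
  have ee0 : e != e0 by apply: contra uu0 => /eqP->.
  have [e1 [e1y e10 l1]] := leaf y e0 e ey ee0.
  have e1F : mk e1 \in F by rewrite inE in e1y.
  have n1 : mk e1 != mk e0 by apply: contra e10 => /eqP/mk_inj->.
  have [_ /(_ l1)] := two_shared e1F (coreF _ e1F n1).
  by case/sharedP=> _ [y' [? ? _]]; exists y'.
have [_ _ sp _] := S_good.
apply: (@leq_ltn_trans #|tags|).
  apply: (sp _ (tag u0)); first by exists y.
  move=> z zt zu0; have [e [e' [_ _ ee' h h']]] := two_leaves z zt zu0.
  apply/card_gt1P; exists (anchor e), (anchor e'); split=> //.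
  by apply: contra ee' => /eqP/anchor_inj->.
(* Two leaves in one copy show that [tag] is not injective on [F], which gives the extra edge. *)
rewrite ltn_neqAle leq_imset_card andbT; apply/imset_injP => inj.
have [e [e' [ey e'y ee' _ _]]] := two_leaves y yt yu0.
rewrite !inE in ey e'y; have /mk_inj/eqP := inj _ _ ey e'y erefl.
by rewrite (negPf ee').
Qed.

(** The edge [y] forced in [S] comes first: its vertex at position [K] then decides how colour [c]
    is split in the copy below [y]. *)
Lemma amalgam_order_forcing : order_forcing amalgam.
Proof.
move=> f lam injf.
have [_ sz _ frc] := S_good.
have injl : injective (f \o inl) by move=> a b /injf[].
have [y /andP[fy /allP ly]] := frc _ (lam \o inl) injl.
pose c := hcolor y; pose a i := nth (hpoint S) (htuple y) i.
have a_lt i j : i < j -> j < K + K -> f (inl (a i)) < f (inl (a j)).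
  move=> ij jK; have js := leq_trans jK (sz y).
  have /(pairwiseP (hpoint S)) h := fy.
  by apply: (h i j) => //; apply: ltn_trans js.
pose lam' (v : hvertex (T c)) : option C :=
  if lam (copy v) != c then Some (lam (copy v))
  else if f (copy v) < f (inl (a K)) then Some c else None.
have injr : injective (f \o @copy y) by move=> v w /injf/copy_inj.
have [_ _ _ frcT] := T_good c.
have [e /andP[fe /allP le]] := frcT _ lam' injr.
exists (mk e).
have fe' : pairwise (relpre f ltn) (map (@copy y) (htuple e)).
  by rewrite pairwise_map.
have anc_c : lam (inl (anchor e)) = c.
  by apply/eqP; apply: (ly (anchor e)); apply: mem_anchor.
have ltK : enum_rank e < K by apply: leq_trans (ltn_ord _) (T_small c).
rewrite /= /amalgam_tuple /amalgam_color /=.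
rewrite /anchor /anchor_index -/(a _) in anc_c *.
(* For colour [Some c] all vertices of [e] come before [a K], and the anchor is [a K] or later. *)
case he: (hcolor e) anc_c => [q|] anc_c.
  have lq v : v \in htuple e -> lam (copy v) = q.
    move/le => /eqP; rewrite he /lam'; case: (lam _ =P c) => [->|_] /=.
      by case: ifP => // _ [].
    by case.
  have aq : all (fun v => lam v == q) (map (@copy y) (htuple e)).
    by apply/allP => _ /mapP[v ve ->]; rewrite lq.
  case: eqP => [qc|_]; last by rewrite fe'.
  rewrite pairwise_rcons fe' all_rcons aq anc_c qc eqxx !andbT.
  apply/allP=> _ /mapP[v ve ->] /=.
  have := le v ve; rewrite he /lam' lq // qc eqxx /=.
  case: ifP => // lt_va _; apply: leq_trans lt_va _.
  have [->|r_gt0] := posnP (enum_rank e); first by rewrite addn0.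
  by apply/ltnW/a_lt; rewrite ?ltn_add2l // -[X in X < _]addn0 ltn_add2l.
(* For colour [None] the vertices do not come before [a K], whereas the anchor does. *)
have lv v : v \in htuple e -> lam (copy v) = c /\ f (inl (a K)) <= f (copy v).
  move/le => /eqP; rewrite he /lam'; case: (lam _ =P c) => [->|_] //=.
  by case: ltnP.
rewrite /= fe' anc_c eqxx andbT /=; apply/andP; split; apply/allP=> _ /mapP[v ve ->].
  have [_] := lv v ve; apply: leq_trans; apply: a_lt => //.
  by rewrite -[X in X < _]addn0 ltn_add2l; apply: leq_trans ltK.
by have [-> _] := lv v ve.
Qed.

Lemma amalgam_good : good amalgam rho g.+1.
Proof.
split; [exact: amalgam_tuple_uniq | exact: amalgam_tuple_size |
        exact: amalgam_sparse | exact: amalgam_order_forcing].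
Qed.

End Amalgamation.

(** * The double induction *)

(** The term [3 ^ rho c] gives way to two terms [3 ^ (rho c).-1]; the base exceeds the number of
    parts. *)
Lemma split_target_measure (C : finType) (rho : C -> nat) (c : C) :
  0 < rho c ->
  \sum_o 3 ^ split_target rho c o < \sum_q 3 ^ rho q.
Proof.
move=> rc; rewrite big_option_nat /= (bigD1 c) //= [ltnRHS](bigD1 c) //=.
rewrite eqxx subn1 addnA (eq_bigr (fun q => 3 ^ rho q)); last first.
  by move=> q /negPf->; rewrite subn0.
rewrite ltn_add2r -(prednK rc) /= expnS !mulSn mul0n addn0 addnA.
by rewrite -[X in X < _]addn0 ltn_add2l expn_gt0.
Qed.

(** Both inductions are uniform in [C], since splitting adds a colour, and in [rho], since the
    target for [S] depends on the [T c] already chosen. *)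
Lemma exists_good (g : nat) (C : finType) (rho : C -> nat) :
  exists H : hypergraph C, good H rho g.
Proof.
elim: g C rho => [|g IHg] C rho; first exact: good_base.
have [m] := ubnP (\sum_q 3 ^ rho q); elim: m C rho => // m IHm C rho lt_m.
have [/existsP[q /eqP]|] := boolP [exists q, rho q == 0].
  exact: good_trivial.
rewrite negb_exists => /forallP rho0.
have rho_gt0 q : 0 < rho q by rewrite lt0n.
have hT c : exists T : hypergraph (option C), good T (split_target rho c) g.+1.
  apply: IHm; apply: leq_trans (split_target_measure (rho_gt0 c)) _.
  by rewrite -ltnS.
have [T T_good] := fin_all_exists hT.
(* This bounds the edges of every [T c] at once, so each half of an edge of [S] has room for all
   anchors. *)
pose K := \sum_c #|hedge (T c)|.
have [S S_good] := IHg C (fun=> K + K).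
exists (amalgam K S T); apply: amalgam_good => // c.
by rewrite /K (bigD1 c) //= leq_addr.
Qed.

(** * The graph of cycles and its girth *)

(** A duplicate-free sequence is a single orbit of [next]. *)
Lemma next_closed (T : finType) (s : seq T) (P : pred T) x :
  uniq s -> x \in s -> P x -> {in s, forall y, P y -> P (next s y)} ->
  {in s, forall y, P y}.
Proof.
move=> us xs Px cl y; rewrite -(fconnect_cycle (cycle_next us) xs).
move/iter_findex <-; set n := findex _ _ _.
suff /andP[] : (iter n (next s) x \in s) && P (iter n (next s) x) by [].
elim: n => [|n /andP[ns nP]] /=; first by rewrite xs.
by rewrite mem_next ns cl.
Qed.

(** Otherwise [x] and [next s x] would be closed under [next] and exhaust [s]. *)
Lemma next_neq_prev (T : finType) (s : seq T) x :
  uniq s -> x \in s -> 2 < size s -> next s x != prev s x.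
Proof.
move=> us xs; apply: contraTneq => E; rewrite -leqNgt.
apply: (@uniq_leq_size _ s [:: x; next s x]) => // y ys; rewrite mem_seq2.
apply: (next_closed (P := pred2 x (next s x)) us xs) ys; first by rewrite /= eqxx.
by move=> z _ /= /orP[] /eqP->; rewrite ?eqxx ?orbT // E next_prev ?eqxx.
Qed.

Section CycleGraph.
Variables (C : finType) (H : hypergraph C).

Definition linked (e : hedge H) (x y : hvertex H) : bool :=
  [&& x \in htuple e, y \in htuple e &
      (next (htuple e) x == y) || (next (htuple e) y == x)].

Definition cycle_adj : rel (hvertex H) :=
  fun x y => (x != y) && [exists e, linked e x y].

Lemma cycle_adj_sym : symmetric cycle_adj.
Proof.
move=> x y; rewrite /cycle_adj eq_sym; congr (_ && _).
by apply: eq_existsb => e; rewrite /linked andbCA orbC.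
Qed.

Lemma cycle_adj_irrefl : irreflexive cycle_adj.
Proof. by move=> x; rewrite /cycle_adj eqxx. Qed.

Definition cycle_graph : sgraph := SGraph cycle_adj_sym cycle_adj_irrefl.

Hypothesis tuple_uniq : forall e : hedge H, uniq (htuple e).

(** Label each edge of the cycle by a hyperedge containing it. If several labels occur, each shares
    two vertices with the others and sparsity applies; if only one occurs, the cycle runs through
    that whole hyperedge. *)
Lemma cycle_graph_girth (k : nat) :
  (forall e : hedge H, k <= size (htuple e)) -> sparse H k ->
  girth_at_least k cycle_graph.
Proof.
move=> sz sp; apply/girth_at_leastP => c c3 /andP[cc uc].
have [x0 x0c] : exists x, x \in c.
  by case: c c3 {cc uc} => // x c _; exists x; apply: mem_head.
have link x : x \in c -> exists e, linked e x (next c x).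
  by move/(next_cycle cc) => /andP[_ /existsP].
have [e0 _] := link x0 x0c.
pose ell x := odflt e0 [pick e | linked e x (next c x)].
have ellP x : x \in c -> linked (ell x) x (next c x).
  move/link => [e he]; rewrite /ell; case: pickP => //= no.
  by rewrite no in he.
have in_l x : x \in c -> x \in htuple (ell x) by case/ellP/and3P.
have in_r x : x \in c -> next c x \in htuple (ell x) by case/ellP/and3P.
pose F := [set ell x | x in c].
have Fc : #|F| <= size c := leq_trans (leq_imset_card _ _) (card_size _).
have ellF x : x \in c -> ell x \in F by move=> xc; apply/imsetP; exists x.
have [/exists_inP[e1 e1F e10]|] := boolP [exists e in F, e != ell x0].
  apply: leq_trans Fc; apply: (sp _ (ell x0)); first by exists e1.
  move=> _ /imsetP[z zc ->] nz; set e := ell z in nz *.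
  (* At [next c y] the cycle leaves a run labelled [e]; at [next c w], with [w] as below, it enters
     one. *)
  have [y [yc ye ny]] : exists y, [/\ y \in c, ell y = e & ell (next c y) != e].
    have [/hasP[y yc /andP[/eqP ? ?]]|/hasPn h] :=
      boolP (has (fun y => (ell y == e) && (ell (next c y) != e)) c).
      by exists y.
    suff : ell x0 == e by rewrite eq_sym (negPf nz).
    apply: (next_closed (P := fun y => ell y == e) uc zc) x0c => //= y yc yP.
    by move: (h y yc); rewrite yP /= negbK.
  have [w [wc we nw]] : exists y, [/\ y \in c, ell y != e & ell (next c y) = e].
    have [/hasP[w wc /andP[? /eqP ?]]|/hasPn h] :=
      boolP (has (fun y => (ell y != e) && (ell (next c y) == e)) c).
      by exists w.
    suff : ell z != e by rewrite eqxx.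
    apply: (next_closed (P := fun y => ell y != e) uc x0c) zc => [|w wc wP] /=.
      by rewrite eq_sym.
    by move: (h w wc); rewrite wP.
  apply/card_gt1P; exists (next c y), (next c w); split.
  - apply/sharedP; split; first by rewrite -ye in_r.
    by exists (ell (next c y)); rewrite ellF ?in_l ?mem_next.
  - apply/sharedP; split; first by rewrite -nw in_l ?mem_next.
    by exists (ell w); rewrite ellF ?in_r.
  - by apply: contra ny => /eqP->; rewrite nw.
rewrite negb_exists_in => /forall_inP one.
have ell1 x : x \in c -> ell x = ell x0.
  by move/ellF/one; rewrite negbK => /eqP.
set s := htuple (ell x0) in in_l in_r *.
have ellE x : x \in c -> (next s x == next c x) || (next s (next c x) == x).
  by move=> xc; have /and3P[] := ellP x xc; rewrite ell1.
have us : uniq s by apply: tuple_uniq.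
apply: leq_trans (sz (ell x0)) _; apply: uniq_leq_size => // y ys.
have x0s : x0 \in s by apply: in_l.
(* If [next s y] were not on [c], both neighbours of [y] on [c] would precede it in [s] and hence
   coincide. *)
apply: (next_closed (P := mem c) us x0s x0c) ys => {}y _ /= yc.
have pc : prev c y \in c by rewrite mem_prev.
have := ellE y yc; have := ellE _ pc; rewrite next_prev //.
case/orP => /eqP E1; last by rewrite E1.
case/orP => /eqP E2; first by rewrite E2 mem_next.
have E : next c y = prev c y.
  by apply: (can_inj (prev_next us)); rewrite E1.
by have := next_neq_prev uc yc c3; rewrite E eqxx.
Qed.

End CycleGraph.

(** * KT orientations and numberings of the vertices *)

Section Orientation.
Variables (G : sgraph) (D : rel G).
Hypothesis KT : KT_orientation D.

Lemma KT_dipath_unique (u v : G) (s t : seq G) : u != v ->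
  dipath D u v s -> dipath D u v t || dipath D v u t -> s = t.
Proof.
move=> uv hs ht; have [_ /(_ u v uv) le1] := KT.
by apply: ((num_dipaths_le1P D uv).1 le1); rewrite ?hs.
Qed.

(** A directed path back from [y] to [x] would be a second one beside the edge. *)
Lemma KT_acyclic (x y : G) : D x y -> ~~ connect D y x.
Proof.
move=> Dxy; have xy : x != y.
  have [/(_ x x)[]] := KT; rewrite adj_irrefl orbb => Dxx _ _.
  by apply: contraTneq Dxy => <-; rewrite -Dxx.
apply/negP => /connectP[p yp xE].
case/shortenP: yp xE => p' yp' up' _ xE.
have h1 : dipath D x y [:: x; y] by rewrite /= !eqxx Dxy inE xy.
have h2 : dipath D y x (y :: p') by rewrite /dipath xE !eqxx yp'.
have := KT_dipath_unique xy h1; move=> /(_ (y :: p')).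
by rewrite h2 orbT => /(_ isT) [/eqP]; rewrite (negPf xy).
Qed.

Lemma KT_topological_order :
  exists f : G -> nat, injective f /\ forall x y, D x y -> f x < f y.
Proof.
pose h x := #|[set z | connect D z x]|.
have h_lt x y : D x y -> h x < h y.
  move=> Dxy; apply/proper_card/properP; split.
    apply/subsetP=> z; rewrite !inE => zx.
    exact: connect_trans zx (connect1 Dxy).
  by exists y; rewrite !inE ?connect0 ?KT_acyclic.
(* The number of ancestors is the leading digit in base [#|G|]; the rank breaks ties. *)
exists (fun x => h x * #|G| + enum_rank x); split.
  move=> x y /(congr1 (modn^~ #|G|)); rewrite !modnMDl !modn_small ?ltn_ord //.
  by move/ord_inj/enum_rank_inj.
move=> x y /h_lt hxy.
apply: (@leq_trans ((h x).+1 * #|G|)); first by rewrite mulSn addnC ltn_add2r.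
by apply: leq_trans (leq_addr _ _); rewrite leq_mul2r hxy orbT.
Qed.

End Orientation.

(** * Excluding KT orientations *)

Lemma cycle_graph_no_KT (C : finType) (H : hypergraph C) :
  (forall e : hedge H, uniq (htuple e)) ->
  (forall e : hedge H, 2 < size (htuple e)) ->
  (forall f : hvertex H -> nat, injective f ->
     exists e : hedge H, pairwise (relpre f ltn) (htuple e)) ->
  ~ admits_KT_orientation (cycle_graph H).
Proof.
move=> us sz frc [D KT].
have [f [injf f_lt]] := KT_topological_order KT.
have [e fe] := frc f injf.
have [orD _] := KT.
have D_of x y : linked e x y -> f x < f y -> D x y.
  move=> lxy fxy; have [+ _] := orD x y; rewrite /= /cycle_adj.
  have -> : x != y by apply: contraTneq fxy => ->; rewrite ltnn.
  have -> : [exists e, linked e x y] by apply/existsP; exists e.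
  case Dxy: (D x y) => //; case Dyx: (D y x) => //.
  by have := f_lt _ _ Dyx; rewrite ltnNge ltnW.
case Es: (htuple e) (sz e) (us e) fe => [|x p] // sp up fp.
have cyc : fcycle (next (htuple e)) (x :: p) by rewrite -Es cycle_next.
move: cyc; rewrite /= rcons_path => /andP[np /eqP nl].
have pD : path D x p.
  have fp' : path (relpre f ltn) x p.
    by rewrite path_pairwise // => a b c; apply: ltn_trans.
  have: path [rel a b | relpre f ltn a b && frel (next (htuple e)) a b] x p.
    by rewrite path_relI fp' np.
  apply: (@sub_in_path _ (mem (htuple e))); last by apply/allP=> z; rewrite Es.
  move=> a b ae be /andP[/= fab /eqP nab]; apply: D_of => //.
  by rewrite /linked nab ae be eqxx.
have pnil : p != [::] by case: p sp {Es up fp np nl pD}.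
have lp : last x p \in p by case: p pnil {Es sp up fp np nl pD} => //= y p _; apply: mem_last.
(* The closing edge of the cycle joins the lowest vertex to the highest, so it also leaves [x]. *)
have Dl : D x (last x p).
  apply: D_of; last by move: fp => /= /andP[/allP/(_ _ lp)].
  by rewrite /linked Es mem_head inE lp orbT -Es nl eqxx orbT.
have xl : x != last x p by apply: contraTneq up => ->; rewrite /= lp.
have h1 : dipath D x (last x p) (x :: p) by rewrite /dipath !eqxx pD.
have h2 : dipath D x (last x p) [:: x; last x p].
  by rewrite /= !eqxx Dl inE xl.
have := KT_dipath_unique KT xl h1; move=> /(_ [:: x; last x p]).
rewrite h2 => /(_ isT) E; by rewrite E in sp.
Qed.

Theorem theorem4p3 (k : nat) :
  exists G : sgraph, girth_at_least k G /\ ~ admits_KT_orientation G.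
Proof.
(* One colour makes the colouring trivial; size 3 keeps the increasing path distinct from the
   closing edge. *)
have [H [us sz sp frc]] := exists_good k (fun _ : unit => maxn k 3).
have szk (e : hedge H) : k <= size (htuple e).
  exact: leq_trans (leq_maxl _ _) (sz e).
have sz3 (e : hedge H) : 2 < size (htuple e).
  exact: leq_trans (leq_maxr _ _) (sz e).
exists (cycle_graph H); split; first exact: cycle_graph_girth.
apply: cycle_graph_no_KT => // f injf.
by have [e /andP[]] := frc f (fun=> tt) injf; exists e.
Qed.
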